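(* For every $k\in\mathbb{N}$, $\operatorname{trasdim}(X_{\omega+k})=\omega+k$, where $X_{\omega+k}=\mathrm{as}\bigsqcup_{i=1}^{\infty}X_{\omega+k}^{(i)}$ and $X_{\omega+k}^{(i)}=\{(x_1,\ldots,x_i)\in\mathbb{R}^i : |\{j : x_j\notin 2^i\mathbb{Z}\}|\leq k\}$.
   Context: $\mathbb{N}=\{1,2,3,\ldots\}$; $\omega$ is the smallest infinite ordinal. Families of subsets. Let $(X,d)$ be a metric space. For $r>0$, a family $\mathcal{U}$ of subsets of $X$ is $r$-disjoint if $d(U,V)=\inf\{d(x,y):x\in U,y\in V\}>r$ for all $U\neq V$ in $\mathcal{U}$. It is uniformly bounded if $\sup\{\operatorname{diam}U:U\in\mathcal{U}\}<\infty$. Transfinite asymptotic dimension. Let $Fin\,\mathbb{N}$ be the collection of all finite nonempty subsets of $\mathbb{N}$. For $M\subseteq Fin\,\mathbb{N}$ and $\sigma\in\{\varnothing\}\cup Fin\,\mathbb{N}$ let $M^{\sigma}=\{\tau\in Fin\,\mathbb{N}:\tau\cup\sigma\in M,\ \tau\cap\sigma=\varnothing\}$, and $M^a=M^{\{a\}}$ for $a\in\mathbb{N}$. Define $\operatorname{Ord}M$ inductively: $\operatorname{Ord}M=0$ iff $M=\varnothing$; $\operatorname{Ord}M\leq\alpha$ (for an ordinal $\alpha>0$) iff $\operatorname{Ord}M^a<\alpha$ for every $a\in\mathbb{N}$; $\operatorname{Ord}M=\alpha$ iff $\operatorname{Ord}M\leq\alpha$ and $\operatorname{Ord}M<\alpha$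 is not true; $\operatorname{Ord}M=\infty$ iff $\operatorname{Ord}M\leq\alpha$ holds for no ordinal $\alpha$. For a metric space $X$, let $A(X)$ be the set of $\sigma\in Fin\,\mathbb{N}$ for which there are no uniformly bounded families $\mathcal{U}_i$ ($i\in\sigma$) of subsets of $X$ such that each $\mathcal{U}_i$ is $i$-disjoint and $\bigcup_{i\in\sigma}\mathcal{U}_i$ covers $X$. Then $\operatorname{trasdim}(X)=\operatorname{Ord}A(X)$. Asymptotic union. For a sequence $\{Z_i\}_{i=1}^\infty$ of subspaces of a metric space $(Z,d_Z)$, the asymptotic union $\mathrm{as}\bigsqcup_{i=1}^{\infty}Z_i$ is the disjoint union of the $Z_i$ with the metric given, for $x$ in the $l$-th summand $Z_l$ and $y$ in the $k$-th summand $Z_k$ with $l\leq k$, by $d(x,y)=d_Z(x,y)+c$, where $c=0$ if $l=k$ and $c=l+(l+1)+\cdots+(k-1)$ if $l<k$. Here each $X_{\omega+k}^{(i)}\subset\mathbb{R}^i$ is regarded as a subspace of $(\bigoplus\mathbb{R},d_{\max})$, the space of finitely supported real sequences with the max metric, where $\mathbb{R}^i$ is identified with the sequences vanishing after the $i$-th coordinate. *)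

(* Defs.v *)
From HB Require Import structures.
From mathcomp Require Import all_boot all_order all_algebra finmap.
From mathcomp Require Import all_classical all_reals ereal topology.
Import Order.TTheory GRing.Theory Num.Theory.

Set Implicit Arguments.
Unset Strict Implicit.
Unset Printing Implicit Defensive.

Local Open Scope classical_set_scope.
Local Open Scope ring_scope.

(** ** Ordinals

[osup f] denotes the least ordinal strictly above every [f i].  Distinct terms
may denote the same ordinal, so ordinals are compared with [ole], [olt] and
[oeq], never with Leibniz equality. *)

Inductive ord : Type := osup (I : Type) (f : I -> ord).

Fixpoint ole (a b : ord) : Prop :=
  match a, b with
  | osup _ f, osup _ g => forall i, exists j, ole (f i) (g j)
  end.

Definition olt (a b : ord) : Prop :=
  match b with osup _ g => exists j, ole a (g j) end.

Definition oeq (a b : ord) : Prop := ole a b /\ ole b a.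

Definition ozero : ord := osup (fun e : Empty_set => match e with end).

Definition osucc (a : ord) : ord := osup (fun _ : unit => a).

Definition omega : ord := osup (fun n : nat => iter n osucc ozero).

Definition omega_plus (k : nat) : ord := iter k osucc omega.

(** ** The ordinal number Ord M of a family of finite sets of naturals

The natural numbers of the theory start at 1. *)

Definition FinN : set {fset nat} :=
  [set s | s != fset0 /\ 0%N \notin s].

Definition residual (M : set {fset nat}) (s : {fset nat}) : set {fset nat} :=
  [set t | [/\ FinN t, M (t `|` s)%fset & (t `&` s)%fset = fset0]].

Inductive Ord_le (M : set {fset nat}) (a : ord) : Prop :=
  | Ord_le_zero : oeq a ozero -> M = set0 -> Ord_le M a
  | Ord_le_pos : olt ozero a ->
      (forall n : nat, (0 < n)%N -> Ord_lt (residual M [fset n]%fset) a) ->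
      Ord_le M a
with Ord_lt (M : set {fset nat}) (a : ord) : Prop :=
  | Ord_lt_intro (b : ord) : olt b a -> Ord_le M b -> Ord_lt M a.

Definition Ord_eq (M : set {fset nat}) (a : ord) : Prop :=
  Ord_le M a /\ ~ Ord_lt M a.

(** ** Transfinite asymptotic dimension *)

Section Trasdim.
Context {R : realType}.

(* The distance to the empty set is [+oo]. *)
Definition set_dist (X : metricType R) (U V : set X) : \bar R :=
  ereal_inf [set (mdist x y)%:E | x in U & y in V].

(* The diameter of the empty set is [-oo]. *)
Definition diam (X : metricType R) (U : set X) : \bar R :=
  ereal_sup [set (mdist x y)%:E | x in U & y in U].

Definition disjoint_family (X : metricType R) (r : R) (F : set (set X)) :=
  forall U V, F U -> F V -> U <> V -> (r%:E < set_dist U V)%E.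

Definition uniformly_bounded (X : metricType R) (F : set (set X)) :=
  (ereal_sup [set diam U | U in F] < +oo)%E.

Definition trasdim_family (X : metricType R) : set {fset nat} :=
  [set s | FinN s /\
    ~ exists F : nat -> set (set X),
        [/\ (forall i, i \in s -> uniformly_bounded (F i)),
            (forall i, i \in s -> disjoint_family i%:R (F i)) &
            \bigcup_(i in [set` s]) \bigcup_(U in F i) U = [set: X]]].

Definition trasdim_eq (X : metricType R) (a : ord) : Prop :=
  Ord_eq (trasdim_family X) a.

End Trasdim.

(** ** Asymptotic unions *)

Section AsymptoticUnion.
Context {R : realType} {T : metricType R}.

(* The sequence [Z] is indexed from 1: the value [Z 0] is not used. *)
Definition as_union_points (Z : nat -> set T) : set (nat * T) :=
  [set p | (0 < p.1)%N /\ Z p.1 p.2].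

Definition as_union (Z : nat -> set T) : Type := set_type (as_union_points Z).

Context (Z : nat -> set T).

HB.instance Definition _ := Choice.copy (as_union Z)
  (set_type (as_union_points Z)).

Definition as_gap (l k : nat) : nat := \sum_(minn l k <= m < maxn l k) m.

Definition as_dist (p q : as_union Z) : R :=
  mdist (val p).2 (val q).2 + (as_gap (val p).1 (val q).1)%:R.

Let gap_sym l k : as_gap l k = as_gap k l.
Proof. by rewrite /as_gap minnC maxnC. Qed.

Let gap_triangle m l k : (as_gap l k <= as_gap l m + as_gap m k)%N.
Proof.
pose S a b := (\sum_(a <= i < b) i)%N.
have Scat a b c : (a <= b)%N -> (b <= c)%N -> S a c = (S a b + S b c)%N.
  by move=> ab bc; rewrite /S (big_cat_nat ab bc).
wlog lk : l k / (l <= k)%N.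
  by move=> H; have [/H//|/ltnW/H] := leqP l k; rewrite addnC gap_sym
    (gap_sym k m) (gap_sym m l).
have gapE a b : (a <= b)%N -> as_gap a b = S a b.
  by move=> ab; rewrite /as_gap (minn_idPl ab) (maxn_idPr ab).
rewrite (gapE l k)//; have [lm|/ltnW ml] := leqP l m.
  rewrite (gapE l m)//; have [mk|/ltnW km] := leqP m k.
    by rewrite (gapE m k)// (Scat l m k).
  by rewrite (Scat l k m)// -addnA leq_addr.
by rewrite (gapE m k) ?(leq_trans ml)// (Scat m l k)// addnA leq_addl.
Qed.

Let as_distxx p : as_dist p p = 0.
Proof. by rewrite /as_dist mdistxx add0r /as_gap minnn maxnn big_geq. Qed.

Let as_dist_positivity p q : as_dist p q = 0 -> p = q.
Proof.
move=> /eqP; rewrite paddr_eq0 ?mdist_ge0// => /andP[/eqP/mdist_positivity e2].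
rewrite pnatr_eq0 => /eqP g0; apply/val_inj.
suff e1 : (val p).1 = (val q).1.
  by move: e1 e2; case: (val p) (val q) => [? ?] [? ?] /= -> ->.
have [[p0 _] [q0 _]] := (set_mem (valP p), set_mem (valP q)).
have min0 : (0 < minn (val p).1 (val q).1)%N by rewrite leq_min p0.
apply/eqP; move: g0; rewrite /as_gap; apply: contra_eqT => pq.
rewrite big_ltn; last by rewrite gtn_min !leq_max !ltnn orbF -neq_ltn.
by rewrite -lt0n ltn_addr.
Qed.

Let as_dist_sym p q : as_dist p q = as_dist q p.
Proof. by rewrite /as_dist metric_sym gap_sym. Qed.

Let as_dist_triangle q p r : as_dist p r <= as_dist p q + as_dist q r.
Proof.
by rewrite /as_dist addrACA lerD ?metric_triangle// -natrD ler_nat gap_triangle.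
Qed.

HB.instance Definition _ := isMetric.Build R (as_union Z)
  as_distxx as_dist_positivity as_dist_sym as_dist_triangle.

End AsymptoticUnion.

(** ** Finitely supported real sequences with the max metric *)

Section DirectSum.
Context {R : realType}.

Definition finsupp_seq : Type := {fsfun nat -> R with 0}.

Identity Coercion finsupp_seq_fsfun : finsupp_seq >-> fsfun.

HB.instance Definition _ := Choice.copy finsupp_seq {fsfun nat -> R with 0}.

Definition max_dist (x y : finsupp_seq) : R :=
  \big[Num.max/0]_(j <- (finsupp x `|` finsupp y)%fset) `|x j - y j|.

Implicit Types x y z : finsupp_seq.

Let max_dist_ub x y j : `|x j - y j| <= max_dist x y.
Proof.
rewrite /max_dist; have [jS|] := boolP (j \in (finsupp x `|` finsupp y)%fset).
  exact: (le_bigmax_seq 0 j xpredT (fun i => `|x i - y i|)).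
rewrite in_fsetU negb_or => /andP[jx jy].
by rewrite !fsfun_dflt// subrr normr0 bigmax_ge_id.
Qed.

Let max_dist_le x y (e : R) : 0 <= e -> (forall j, `|x j - y j| <= e) ->
  max_dist x y <= e.
Proof. by move=> e0 H; apply: bigmax_le. Qed.

Let max_dist_ge0 x y : 0 <= max_dist x y.
Proof. exact: bigmax_ge_id. Qed.

Let max_distxx x : max_dist x x = 0.
Proof.
apply/eqP; rewrite eq_le max_dist_ge0 andbT.
by apply: max_dist_le => // j; rewrite subrr normr0.
Qed.

Let max_dist_positivity x y : max_dist x y = 0 -> x = y.
Proof.
move=> xy; apply/fsfunP => j; apply/eqP; rewrite -subr_eq0 -normr_le0.
by apply: le_trans (max_dist_ub x y j) _; rewrite xy.
Qed.

Let max_dist_sym x y : max_dist x y = max_dist y x.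
Proof.
by apply/eqP; rewrite eq_le !max_dist_le// => j; rewrite distrC max_dist_ub.
Qed.

Let max_dist_triangle y x z : max_dist x z <= max_dist x y + max_dist y z.
Proof.
apply: max_dist_le => [|j]; first by rewrite addr_ge0.
by rewrite (le_trans (ler_distD (y j) _ _))// lerD ?max_dist_ub.
Qed.

HB.instance Definition _ := isMetric.Build R finsupp_seq
  max_distxx max_dist_positivity max_dist_sym max_dist_triangle.

End DirectSum.

Arguments finsupp_seq : clear implicits.

(** ** The spaces [X_(omega + k)] *)

Definition two_pow_Z (R : realType) (i : nat) : set R :=
  [set 2 ^+ i * m%:~R | m in [set: int]].

Arguments two_pow_Z : clear implicits.

(* The coordinates [x_1, ..., x_i] are [x 0, ..., x i.-1]; the
   first conjunct identifies [R^i] with the sequences vanishing afterwards. *)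
Definition X_omega_piece (R : realType) (k i : nat) : set (finsupp_seq R) :=
  [set x : finsupp_seq R | (forall j : nat, (i <= j)%N -> x j = 0) /\
           (#|[pred j : 'I_i | x j \notin two_pow_Z R i]| <= k)%N].

Arguments X_omega_piece : clear implicits.

Definition X_omega (R : realType) (k : nat) : metricType R :=
  as_union (X_omega_piece R k).

(* Main.v *)
Require Import Defs.
From mathcomp Require Import all_boot all_order all_algebra finmap.
From mathcomp Require Import all_classical all_reals ereal topology.
From mathcomp Require Import zify lra.

Set Implicit Arguments.
Unset Strict Implicit.
Unset Printing Implicit Defensive.

Import Order.TTheory GRing.Theory Num.Theory.
Local Open Scope classical_set_scope.
Local Open Scope ring_scope.

(** Upper bound.  The inequality Ord M <= omega + k holds as soon as, for every
set [s] of [k.+1] numbers, the members of [M] containing [s] have bounded size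
([Ord_le_omega_plus]).  Given [k.+1] scales, take [q] large compared with them.
All pieces of index at least [q] lie in the [k]-skeleton of the grid of mesh
[2 ^ q] of their own Euclidean space, and are more than the given scales apart
from each other.  The [k]-skeleton of a grid of large mesh is covered by [k.+1]
separated families whose members have size at most the mesh, in every dimension
([cell_family_disjoint], [cell_family_bounded], [cell_family_cover]).  The
pieces of index below [q] lie together in a space of dimension less than [q],
and the same construction covers them with any [q.+1] further scales, however
large these are.

Lower bound.  The [k] scales [1, ..., k] are fixed; for each [n] there are [n]
further scales, larger than [2 ^ d] with [d = n + k], such that no families at
these [d] scales cover the piece of index [d] ([trasdim_family_colours]).  This
is a Lebesgue covering argument, one coordinate per family.  For the [j]-th
family, the members that reach the region [x_j <= 0] are joined to that region;
the boundary of what results is a wall that meets no member of the family and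
separates [x_j <= 0] from large [x_j], the members being bounded.  As the [n]
large scales exceed the mesh [2 ^ d], the [n] walls for them can be built from
whole faces of the grid; their intersection then has codimension [n], hence is
contained in the [k]-skeleton.  There the remaining [k] walls, built from unit
cubes, cut out points of the space that belong to no member of any family.

That the intersection of all [d] walls is nonempty is a statement about
intersection numbers mod 2, proved by counting: the walls are cut out one after
the other in the cubical structure of the integer lattice as chains with
coefficients in ['F_2], and the last chain has an odd number of points
([chain_odd]).  Only integer points are used, so no topology is needed. *)

(** * The transfinite order of a family of finite sets *)

Section TransfiniteOrder.
Local Open Scope fset_scope.

Lemma ole_refl a : ole a a.
Proof. by elim: a => I f IH /= i; exists i. Qed.

Lemma ole_trans b a c : ole a b -> ole b c -> ole a c.
Proof.
elim: a b c => I f IH [J g] [K h] /= fg gh i.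
by have [j /IH fgj] := fg i; have [l /fgj] := gh j; exists l.
Qed.

Lemma olt_ole_trans b a c : olt a b -> ole b c -> olt a c.
Proof.
case: b c => [J g] [K h] /= [j aj] gh.
by have [l gl] := gh j; exists l; apply: ole_trans gl.
Qed.

Lemma olt_osucc a : olt a (osucc a).
Proof. by exists tt; apply: ole_refl. Qed.

Lemma olt_osuccE a b : olt a (osucc b) -> ole a b.
Proof. by case. Qed.

Lemma ozero_le a : ole ozero a.
Proof. by case: a => I f []. Qed.

Lemma Ord_le_finite (M : set {fset nat}) (n : nat) :
  (forall t, M t -> FinN t /\ (#|` t| <= n)%N) ->
  Ord_le M (iter n osucc ozero).
Proof.
elim: n M => [|n IH] M Mn.
  apply: Ord_le_zero; first by split; apply: ole_refl.
  apply/seteqP; split=> // t /Mn [[t0 _]].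
  by rewrite leqn0 cardfs_eq0 (negPf t0).
apply: Ord_le_pos => [|a a0]; first by exists tt; apply: ozero_le.
apply: (Ord_lt_intro (olt_osucc _)); apply: IH => t [tF tM ta]; split=> //.
have [_] := Mn _ tM.
by rewrite cardfsU ta cardfs0 subn0 cardfs1 addn1.
Qed.

Lemma FinN_fset1 a : (0 < a)%N -> FinN [fset a].
Proof.
move=> a0; split; last by rewrite inE eq_sym -lt0n.
by apply/fset0Pn; exists a; rewrite inE.
Qed.

(** Peeling off one element lowers the order by one, so [k] steps lead to a
residual of order at most [omega]; one more element leaves a residual with a
bound on the size of its members, hence of finite order. *)
Lemma Ord_le_omega_plus (k : nat) (M : set {fset nat}) :
  (forall s, FinN s -> #|` s| = k.+1 ->
    exists m, forall t, residual M s t -> (#|` t| <= m)%N) ->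
  Ord_le M (omega_plus k).
Proof.
elim: k M => [|k IH] M Mk.
  apply: Ord_le_pos => [|a a0]; first by exists 0%N; apply: ozero_le.
  have [m Mm] := Mk _ (FinN_fset1 a0) (cardfs1 a).
  apply: (@Ord_lt_intro _ _ (iter m osucc ozero)).
    by exists m; apply: ole_refl.
  by apply: Ord_le_finite => t tM; split; [case: tM|exact: Mm].
apply: Ord_le_pos => [|a a0]; first by exists tt; apply: ozero_le.
apply: (Ord_lt_intro (olt_osucc _)); apply: IH => s [s0 sn0] sk.
have [sa|sa] := boolP (a \in s).
  exists 0%N => t [_ [_ _ /fsetP/(_ a)]].
  by rewrite !inE sa orbT eqxx.
have [||m Mm] := Mk (a |` s).
- split; first by apply/fset0Pn; exists a; rewrite !inE eqxx.
  by rewrite !inE negb_or sn0 eq_sym -lt0n a0.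
- by rewrite cardfsU1 sa sk.
exists m => t [tF [_ tsa tsa0] ts0]; apply: Mm; split=> //.
  by rewrite (fsetUC [fset a]) fsetUA.
apply/fsetP => x; move/fsetP: ts0 => /(_ x); move/fsetP: tsa0 => /(_ x).
by rewrite !inE; case: (x \in t); case: (x == a); case: (x \in s).
Qed.

Lemma residual_nonzero (M : set {fset nat}) (a : nat) (b : ord) :
  residual M [fset a] !=set0 -> (0 < a)%N -> Ord_le M b ->
  exists2 c, olt c b & Ord_le (residual M [fset a]) c.
Proof.
move=> [t [_ tM _]] a0 [_ M0|_ /(_ a a0)]; first by rewrite M0 in tM.
by case=> c cb Mc; exists c.
Qed.

Lemma residual_fsetD1 (M : set {fset nat}) (a : nat) (t : {fset nat}) :
  a \in t -> FinN (t `\ a) -> M t -> residual M [fset a] (t `\ a).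
Proof.
move=> ta tF tM; split=> //; first by rewrite fsetUC fsetD1K.
by apply/fsetP => x; rewrite !inE; case: (x == a); rewrite ?andbF.
Qed.

Lemma card_le_Ord (M : set {fset nat}) (b : ord) (n : nat) (t : {fset nat}) :
  Ord_le M b -> ole b (iter n osucc ozero) -> M t -> FinN t ->
  (#|` t| <= n)%N.
Proof.
elim: n M b t => [|n IH] M b t Mb bn tM [t0 tn0].
  case: Mb bn => [_ M0|]; first by rewrite M0 in tM.
  by case: b => I f [i _] _ /(_ i)[[]].
rewrite leqNgt; apply/negP => nt.
have /fset0Pn[a ta] := t0.
have ct : #|` t| = #|` t `\ a|.+1 by rewrite (cardfsD1 a) ta.
have tF : FinN (t `\ a).
  split; last by rewrite !inE (negPf tn0) andbF.
  by rewrite -cardfs_gt0; move: nt; rewrite ct ltnS; apply: leq_ltn_trans.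
have a0 : (0 < a)%N by rewrite lt0n; apply: contraNneq tn0 => <-.
have ra := residual_fsetD1 ta tF tM.
have [|c cb Mc] := residual_nonzero _ a0 Mb; first by exists (t `\ a).
have := IH _ _ _ Mc (olt_osuccE (olt_ole_trans cb bn)) ra tF.
by rewrite leqNgt -ltnS -ct nt.
Qed.

(** Removing the elements of [s] one by one spends the [k] successor steps, and
what is left contains arbitrarily large sets, so it has no finite order. *)
Lemma Ord_ge_omega_plus (k : nat) (M : set {fset nat}) (s : {fset nat})
    (b : ord) :
  0%N \notin s -> #|` s| = k ->
  (forall n, exists t, [/\ FinN t, (n < #|` t|)%N, (t `&` s) = fset0 &
    M (t `|` s)]) ->
  Ord_le M b -> ~ olt b (omega_plus k).
Proof.
elim: k M s b => [|k IH] M s b s0 sk Mn Mb bk.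
  move: sk => /eqP; rewrite cardfs_eq0 => /eqP sE.
  case: bk => n bn; have [t [tF nt _]] := Mn n.
  rewrite sE fsetU0 => tM.
  by have := card_le_Ord Mb bn tM tF; rewrite leqNgt nt.
have /fset0Pn[a sa] : s != fset0 by rewrite -cardfs_gt0 sk.
have a0 : (0 < a)%N by rewrite lt0n; apply: contraNneq s0 => <-.
have {}Mn n : exists t, [/\ FinN t, (n < #|` t|)%N, (t `&` (s `\ a)) = fset0 &
    residual M [fset a] (t `|` s `\ a)].
  have [t [[t0 tn0] nt ts tM]] := Mn n.
  have ta : a \notin t.
    by apply/negP => ta; move/fsetP: ts => /(_ a); rewrite !inE sa ta.
  have tE : t `|` s `\ a = (t `|` s) `\ a.
    apply/fsetP => x; rewrite !inE; have [->|//] := eqVneq x a.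
    by rewrite (negPf ta).
  exists t; split=> //.
    apply/fsetP => x; move/fsetP: ts => /(_ x).
    by rewrite !inE; case: (x \in t); case: (x == a).
  rewrite tE; apply: residual_fsetD1 => //; first by rewrite !inE sa orbT.
  split; last by rewrite !inE negb_and !negb_or tn0 s0 orbT.
  rewrite -tE; have /fset0Pn[x xt] := t0.
  by apply/fset0Pn; exists x; rewrite inE xt.
have [|c cb Mc] := residual_nonzero _ a0 Mb.
  by have [t [_ _ _]] := Mn 0%N; exists (t `|` s `\ a).
apply: (IH _ (s `\ a) c _ _ Mn Mc).
- by rewrite !inE (negPf s0) andbF.
- by move: sk; rewrite (cardfsD1 a) sa => -[].
- exact: olt_ole_trans cb (olt_osuccE bk).
Qed.

End TransfiniteOrder.

(** * Chains mod 2 in the cubical lattice *)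

(** Cubes of the integer lattice are encoded by doubled coordinates of their
centres: a point [y : nat -> int] is the cube which, in direction [i], is the
vertex [y i / 2] if [y i] is even and the unit interval centred at [y i / 2] if
[y i] is odd.  A chain is an arbitrary ['F_2]-valued function of [y]; no
finiteness is required, as each cube has finitely many cofaces. *)
Definition evenz (a : int) : bool := (2 %| a)%Z.

Definition upd (y : nat -> int) (i : nat) (a : int) : nat -> int :=
  fun l => if l == i then a else y l.

Lemma upd_same y i a : upd y i a i = a.
Proof. by rewrite /upd eqxx. Qed.

Lemma upd_other y i a l : l != i -> upd y i a l = y l.
Proof. by rewrite /upd => /negPf->. Qed.

Lemma upd_upd y i a b : upd (upd y i a) i b = upd y i b.
Proof. by apply/funext => l; rewrite /upd; case: eqP. Qed.

Lemma upd_comm y i l a b : i != l -> upd (upd y i a) l b = upd (upd y l b) i a.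
Proof.
move=> il; apply/funext => h; rewrite /upd.
by have [->|//] := eqVneq h l; rewrite eq_sym (negPf il).
Qed.

Lemma upd_id y i : upd y i (y i) = y.
Proof. by apply/funext => l; rewrite /upd; case: eqP => [->|]. Qed.

Lemma evenzD1 a : evenz (a + 1) = ~~ evenz a.
Proof. rewrite /evenz; lia. Qed.

Lemma evenzB1 a : evenz (a - 1) = ~~ evenz a.
Proof. rewrite /evenz; lia. Qed.

Lemma addFF (a : 'F_2) : a + a = 0.
Proof. by apply: addrr_pchar2; apply: pchar_Fp. Qed.

Section Boundary.
Context (d : nat).
Implicit Types (z : (nat -> int) -> 'F_2) (y : nat -> int).

Definition sides z i y : 'F_2 :=
  z (upd y i (y i + 1)) + z (upd y i (y i - 1)).

(** The cubical boundary: the cubes with [y] as a facet are obtained by moving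
one even coordinate of [y] to a neighbouring odd value. *)
Definition bnd z y : 'F_2 := \sum_(i < d | evenz (y i)) sides z i y.

Lemma sum_symmetric0 (n : nat) (q : nat -> nat -> 'F_2) :
  (forall i l, q i l = q l i) -> (forall i, q i i = 0) ->
  \sum_(i < n) \sum_(l < n) q i l = 0.
Proof.
move=> qC q0; elim: n => [|n IH]; first by rewrite big_ord0.
rewrite big_ord_recr /= big_ord_recr /= q0 addr0.
under eq_bigr => i _ do rewrite big_ord_recr /=.
rewrite big_split /= IH add0r -big_split /= big1// => i _.
by rewrite qC addFF.
Qed.

Lemma bnd_bnd z y : bnd (bnd z) y = 0.
Proof.
pose q (i l : nat) : 'F_2 := if [&& i != l, evenz (y i) & evenz (y l)] then
    sides (sides z l) i y else 0.
rewrite -[RHS](@sum_symmetric0 d q) /=; first last.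
- by move=> i; rewrite /q eqxx.
- move=> i l; rewrite /q eq_sym [evenz (y i) && _]andbC.
  case: ifP => // /and3P[li _ _].
  rewrite /sides /= !upd_other// 1?eq_sym//.
  by rewrite ![upd (upd y i _) l _]upd_comm 1?eq_sym// addrACA.
rewrite /bnd [LHS]big_mkcond; apply: eq_bigr => i _ /=.
case: ifP => [yi|yi]; last by rewrite big1// => l _; rewrite /q yi andbF.
rewrite /sides /= -!/(bnd _ _) [X in X + _]big_mkcond [X in _ + X]big_mkcond.
rewrite -big_split /=; apply: eq_bigr => l _; rewrite /q yi /=.
have [il|il] := eqVneq (i : nat) l.
  by rewrite -il !upd_same evenzD1 evenzB1 yi addr0.
rewrite !upd_other 1?eq_sym//.
by case: ifP; rewrite ?addr0// /sides !upd_other 1?eq_sym.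
Qed.

Lemma bnd_eq0 z y :
  (forall i : nat, (i < d)%N -> evenz (y i) -> sides z i y = 0) -> bnd z y = 0.
Proof. by move=> z0; apply: big1 => i /z0; apply. Qed.

Definition coface y y' := exists2 i : nat, (i < d)%N /\ evenz (y i) &
  y' = upd y i (y i + 1) \/ y' = upd y i (y i - 1).

Lemma bnd_neq0 z y : bnd z y != 0 -> exists2 y', coface y y' & z y' != 0.
Proof.
apply: contra_neqP => nz; apply: bnd_eq0 => i id yi; rewrite /sides.
have z0 y' : coface y y' -> z y' = 0.
  by move=> yy'; apply: contra_notP nz => /eqP; exists y'.
by rewrite !z0 ?addr0//; exists i; [|right| |left].
Qed.

(** The restriction of a chain without boundary to a region can only have
boundary where the region changes. *)
Lemma bnd_restrict_const (f : (nat -> int) -> bool) (b : bool) z y :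
  (forall y', coface y y' -> z y' != 0 -> f y' = b) -> bnd z y = 0 ->
  bnd (fun y' => (f y')%:R * z y') y = 0.
Proof.
move=> fb zy0; transitivity (b%:R * bnd z y); last by rewrite zy0 mulr0.
rewrite /bnd mulr_sumr; apply: eq_bigr => i yi; rewrite /sides mulrDr.
have fE y' : coface y y' -> (f y')%:R * z y' = b%:R * z y'.
  by move=> yy'; have [->|/fb->//] := eqVneq (z y') 0; rewrite !mulr0.
by rewrite !fE//; exists i => //; [right|left].
Qed.

(** Iterated rather than multi-indexed summation: each of the following
properties is then an induction on the list of directions. *)
Fixpoint boxsum (K : nat) (l : seq nat) z y : 'F_2 :=
  if l is i :: l' then \sum_(a < K) boxsum K l' z (upd y i (a%:Z *+ 2))
  else z y.

Lemma boxsum_eq K l z z' y :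
  (forall y', (forall i, i \in l -> evenz (y' i)) ->
    (forall i, i \notin l -> y' i = y i) -> z y' = z' y') ->
  boxsum K l z y = boxsum K l z' y.
Proof.
elim: l y => [|i l IH] y zz' /=; first by apply: zz'.
apply: eq_bigr => a _; apply: IH => y' ev od; apply: zz' => h.
  rewrite inE; have [hl _|hl] := boolP (h \in l); first exact: ev.
  by rewrite orbF => /eqP hi; rewrite od// hi upd_same /evenz; lia.
by rewrite inE negb_or => /andP[hi hl]; rewrite od// upd_other.
Qed.

Lemma boxsum0 K l y : boxsum K l (fun=> 0) y = 0.
Proof. by elim: l y => //= i l IH y; rewrite big1. Qed.

Lemma boxsum_sum K l (I : finType) (P : pred I)
    (g : I -> (nat -> int) -> 'F_2) y :
  boxsum K l (fun y => \sum_(i | P i) g i y) y =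
  \sum_(i | P i) boxsum K l (g i) y.
Proof.
elim: l y => //= i l IH y; rewrite exchange_big /=.
by apply: eq_bigr => a _; rewrite IH.
Qed.

Lemma boxsum_neq0 K l z y : boxsum K l z y != 0 ->
  exists y', [/\ forall i, i \in l -> evenz (y' i),
    forall i, i \notin l -> y' i = y i & z y' != 0].
Proof.
apply: contra_neqP => nz; rewrite -[RHS](boxsum0 K l y).
apply: boxsum_eq => y' ev od; apply/eqP; apply: contra_notT nz => zy'.
by exists y'.
Qed.

Lemma boxsum_sides_notin K l z i y : i \notin l ->
  boxsum K l (sides z i) y = sides (boxsum K l z) i y.
Proof.
elim: l y => //= h l IH y; rewrite inE negb_or => /andP[ih il].
rewrite /sides /= -big_split /=; apply: eq_bigr => a _.
rewrite IH// /sides upd_other//.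
by rewrite ![upd (upd y i _) h _]upd_comm.
Qed.

Lemma boxsum_cons_sides K l z i y : i \notin l ->
  boxsum K (i :: l) (sides z i) y =
  boxsum K l z (upd y i (K%:Z *+ 2 - 1)) + boxsum K l z (upd y i (- 1)).
Proof.
move=> il /=; set G := fun v => boxsum K l z (upd y i v).
have -> : \sum_(a < K) boxsum K l (sides z i) (upd y i (a%:Z *+ 2)) =
    \sum_(a < K) (G (a%:Z *+ 2 + 1) + G (a%:Z *+ 2 - 1)).
  apply: eq_bigr => a _; rewrite boxsum_sides_notin// /sides upd_same.
  by rewrite !upd_upd.
have telescope N : \sum_(a < N) (G (a%:Z *+ 2 + 1) + G (a%:Z *+ 2 - 1)) =
    G (N%:Z *+ 2 - 1) + G (- 1); last exact: telescope.
elim: N => [|N IH]; first by rewrite big_ord0 addFF.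
rewrite big_ord_recr /= IH addrC -addrA [X in _ + X]addrA addFF add0r.
congr (G _ + _); lia.
Qed.

(** The sum in direction [i] telescopes, and its two ends lie outside of the
support of [z]. *)
Lemma boxsum_sides0 K l z i y : uniq l -> i \in l ->
  (forall y', z y' != 0 -> 0 <= y' i <= K%:Z *+ 2 - 2) ->
  boxsum K l (sides z i) y = 0.
Proof.
move=> + + zb; elim: l y => // h l IH y /= /andP[hl ul].
rewrite inE; have [ih _|ih /= il] := eqVneq i h; last first.
  by rewrite big1// => a _; apply: IH.
rewrite -ih in hl *.
rewrite -/(boxsum K (i :: l) _ y) boxsum_cons_sides//.
suff z0 v : (v < 0) || (K%:Z *+ 2 - 2 < v) ->
    boxsum K l z (upd y i v) = 0 by rewrite !z0 ?addr0//; lia.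
apply: contraTeq => /boxsum_neq0[y' [_ od /zb]].
by rewrite od// upd_same; lia.
Qed.
End Boundary.

Lemma coface_coord d y y' l : coface d y y' ->
  y' l = y l \/ evenz (y l) /\ (y' l = y l + 1 \/ y' l = y l - 1).
Proof.
move=> [i [_ yi] yE]; have [->|li] := eqVneq l i; last first.
  by left; case: yE => ->; rewrite upd_other.
by right; split=> //; case: yE => ->; rewrite upd_same; [left|right].
Qed.

Section Chains.
Context (d : nat) (f : nat -> (nat -> int) -> bool).

(** Starting with the sum of all [d]-cubes, the [j]-th step cuts the current
chain along the boundary of the region [f j]. *)
Fixpoint chain (j : nat) (y : nat -> int) : 'F_2 :=
  if j is j'.+1 then bnd d (fun y' => (f j' y')%:R * chain j' y') y
  else [forall l : 'I_d, ~~ evenz (y l)]%:R.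

Lemma chain_cycle j y : bnd d (chain j) y = 0.
Proof.
case: j => [|j]; last exact: bnd_bnd.
apply: bnd_eq0 => i id yi; rewrite /sides /=.
suff -> : [forall l : 'I_d, ~~ evenz (upd y i (y i + 1) l)] =
    [forall l : 'I_d, ~~ evenz (upd y i (y i - 1) l)] by rewrite addFF.
apply: eq_forallb => l; rewrite /upd.
by case: ifP => // _; rewrite evenzD1 evenzB1.
Qed.

Lemma chain_coface j y : chain j.+1 y != 0 ->
  exists2 y', coface d y y' & chain j y' != 0.
Proof.
move=> /bnd_neq0[y' yy' /=].
by case fy' : (f j y'); rewrite ?mul0r ?eqxx// mul1r => nz; exists y'.
Qed.

Lemma chain_eq0_const j y b :
  (forall y', coface d y y' -> chain j y' != 0 -> f j y' = b) ->
  chain j.+1 y = 0.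
Proof. by move=> fb; apply: (bnd_restrict_const fb); apply: chain_cycle. Qed.

Lemma chain_even_card j y : chain j y != 0 ->
  #|[pred i : 'I_d | evenz (y i)]| = j.
Proof.
elim: j y => [|j IH] y.
  rewrite /=; case: forallP => [yo _|_]; last by rewrite eqxx.
  by apply: eq_card0 => i; rewrite !inE; apply/negbTE/yo.
move=> /chain_coface[y' [i [id yi] yE] /IH <-].
rewrite (cardD1 (Ordinal id)) !inE yi add1n; congr _.+1; apply: eq_card => l.
rewrite !inE -val_eqE /=; have [li|li] /= := eqVneq (l : nat) i.
  by rewrite li; case: yE => ->; rewrite upd_same ?evenzD1 ?evenzB1 ?yi.
by case: yE => ->; rewrite upd_other.
Qed.

Context (K : nat).
Hypothesis f_neg : forall j (y : nat -> int), (j < d)%N -> y j <= 0 -> f j y.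
Hypothesis f_big : forall j (y : nat -> int), (j < d)%N ->
  K%:Z *+ 2 - 2 <= y j -> f j y = false.

Lemma chain_support j i y : (j <= d)%N -> (i < j)%N -> chain j y != 0 ->
  0 <= y i <= K%:Z *+ 2 - 2.
Proof.
elim: j i y => // j IH i y jd; rewrite ltnS leq_eqVlt => /predU1P[->|ij] nz.
  apply/andP; split; rewrite leNgt; apply: contra_neqN nz => yj.
    apply: (@chain_eq0_const _ _ true) => y' /(coface_coord j) yy' _.
    apply: f_neg => //; move: yy' yj; rewrite /evenz; lia.
  apply: (@chain_eq0_const _ _ false) => y' /(coface_coord j) yy' _.
  apply: f_big => //; move: yy' yj; rewrite /evenz; lia.
have [y' /(coface_coord i) yy' /(IH i _ (ltnW jd) ij)] := chain_coface nz.
by move: yy'; rewrite /evenz; lia.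
Qed.

(** The [j]-th chain meets in an odd number of cubes the coordinate plane
through a generic point spanned by the first [j] directions (the value [-1] of
the other doubled coordinates is odd, so the plane meets no proper faces).
When direction [j] is cut, the sums in the directions [i < j] vanish by
[boxsum_sides0], while the sum in direction [j] telescopes to its lower end,
where [f j] holds and the previous chain is counted once. *)
Lemma chain_odd j : (j <= d)%N ->
  boxsum K (rev (iota 0 j)) (chain j) (fun=> -1) = 1.
Proof.
elim: j => [_|j IH jd] /=.
  suff -> : [forall l : 'I_d, ~~ evenz (- 1)] by [].
  exact/forallP.
pose g y' := (f j y')%:R * chain j y'.
have jn : j \notin rev (iota 0 j) by rewrite mem_rev mem_iota add0n ltnn.
have -> : rev (0 :: iota 1 j) = j :: rev (iota 0 j).
  by rewrite -[0 :: iota 1 j]/(iota 0 j.+1) -addn1 iotaD rev_cat.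
have ordE i : i \in j :: rev (iota 0 j) = (i < j.+1)%N.
  by rewrite inE mem_rev mem_iota ltnS [RHS]leq_eqVlt.
transitivity (boxsum K (j :: rev (iota 0 j))
    (fun y => \sum_(i < d | (i < j.+1)%N) sides g i y) (fun=> -1)).
  apply: boxsum_eq => y ev od; apply: eq_bigl => i.
  have := ev i; have := od i; rewrite ordE.
  by case: ltnP => _ => [_ ->|->].
rewrite boxsum_sum (bigD1 (Ordinal jd)) ?ltnSn// big1 ?Monoid.mulm1.
  rewrite boxsum_cons_sides//.
  have -> : boxsum K (rev (iota 0 j)) g (upd (fun=> -1) j (K%:Z *+ 2 - 1)) = 0.
    rewrite -[RHS](boxsum0 K (rev (iota 0 j))
      (upd (fun=> -1 : int) j (K%:Z *+ 2 - 1))).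
    apply: boxsum_eq => y _ od; rewrite /g f_big ?mul0r//.
    by rewrite od// upd_same; lia.
  rewrite add0r -(IH (ltnW jd)).
  have -> : upd (fun=> -1 : int) j (-1) = (fun=> -1) by exact: upd_id.
  by apply: boxsum_eq => y _ od; rewrite /g f_neg ?mul1r// od.
move=> i /andP[ij ni].
have {ni}ij : (i < j)%N by rewrite ltn_neqAle -ltnS ij andbT.
apply: boxsum_sides0.
- by rewrite /= jn rev_uniq iota_uniq.
- by rewrite ordE ltnW.
- move=> y'; rewrite /g mulf_eq0 negb_or => /andP[_].
  exact: chain_support (ltnW jd) ij.
Qed.

End Chains.

(** * Coverings of the integer points of a coarse skeleton *)

Section LatticeCover.
Context (d m n : nat).
Implicit Types (x y : nat -> int).

(** The mesh of the grid out of whose cells the [j]-th wall is built. *)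
Definition scale (j : nat) : nat := if (j < n)%N then m else 1%N.

(** The smallest closed cell of the grid of mesh [s] that contains the cube [y]:
a point lies in it unless a grid hyperplane separates it from [y]. *)
Definition box (s : nat) y x := forall i (q : int), (i < d)%N ->
  ((s%:Z * q) *+ 2 <= y i -> s%:Z * q <= x i) /\
  (y i <= (s%:Z * q) *+ 2 -> x i <= s%:Z * q).

Lemma box_coface s y y' x : coface d y y' -> box s y x -> box s y' x.
Proof.
move=> yy' byx i q id; have [b1 b2] := byx i q id.
by move: (coface_coord i yy'); rewrite /evenz; split; lia.
Qed.

(** The two neighbours of [y] in direction [i] are only separated by the
hyperplane through [y], which is not one of the grid. *)
Lemma box_flip s y i x : evenz (y i) -> ~~ ((s%:Z *+ 2) %| y i)%Z ->
  box s (upd y i (y i + 1)) x <-> box s (upd y i (y i - 1)) x.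
Proof.
move=> yi ni; have neq (q : int) : y i != (s%:Z * q) *+ 2.
  by apply: contraNneq ni => ->; rewrite -mulrnAl dvdz_mulr.
split=> b l q ld; have := b l q ld; have := neq q;
  have [->|li] := eqVneq l i; rewrite ?upd_same ?(upd_other _ _ li)//;
  by move: yi; rewrite /evenz; lia.
Qed.

Lemma box_close s y x x' i : (0 < s)%N -> (i < d)%N ->
  box s y x -> box s y x' -> `|x i - x' i| <= s%:Z.
Proof.
move=> s0 id bx bx'; pose q := (y i %/ (s%:Z *+ 2))%Z.
have s2 : s%:Z *+ 2 != 0 by lia.
have lq : (s%:Z * q) *+ 2 <= y i.
  by rewrite -mulrnAl mulrC lez_floor.
have gq : y i <= (s%:Z * (q + 1)) *+ 2.
  by rewrite -mulrnAl mulrC ltW// ltz_ceil//; lia.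
have [/(_ lq) l1 _] := bx i q id; have [_ /(_ gq) g1] := bx i (q + 1) id.
have [/(_ lq) l2 _] := bx' i q id; have [_ /(_ gq) g2] := bx' i (q + 1) id.
by move: l1 g1 l2 g2; rewrite mulrDr mulr1; lia.
Qed.

Context (Fam : nat -> set (set (nat -> int))) (D : nat).

Hypothesis m_gt0 : (0 < m)%N.
Hypothesis n_le_d : (n <= d)%N.
Hypothesis Fam_disjoint : forall j W W' x x', (j < d)%N ->
  Fam j W -> Fam j W' -> W x -> W' x' ->
  (forall i, (i < d)%N -> `|x i - x' i| <= (scale j)%:Z) -> W = W'.
Hypothesis Fam_bounded : forall j W x x', (j < d)%N ->
  Fam j W -> W x -> W x' -> x j - x' j <= D%:Z.

Definition reaches_low (j : nat) (W : set (nat -> int)) :=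
  exists2 x, W x & x j <= 0.

(** The region whose boundary is the [j]-th wall. *)
Definition low_side j y : bool := `[< y j <= 0 \/
  exists W, [/\ Fam j W, reaches_low j W &
    exists2 x, W x & box (scale j) y x] >].

Let scale_gt0 j : (0 < scale j)%N.
Proof. by rewrite /scale; case: ifP. Qed.

Let low_side_neg j y : (j < d)%N -> y j <= 0 -> low_side j y.
Proof. by move=> _ yj; apply/asboolP; left. Qed.

(* [2 * N - 2] is the doubled coordinate [2 * m * (D + 1)]: a cell of mesh at
   most [m] beyond it only has points with [j]-th coordinate above [D]. *)
Let N := (m * D.+1).+1.

Let low_side_big j y : (j < d)%N -> N%:Z *+ 2 - 2 <= y j ->
  low_side j y = false.
Proof.
move=> jd yj; apply/asboolP => -[|[W [FW [x' Wx' x'0] [x Wx bx]]]].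
  by move: yj; rewrite /N; nia.
have [H _] := bx j D.+1 jd; have := Fam_bounded jd FW Wx Wx'.
have sm : (scale j <= m)%N by rewrite /scale; case: ifP.
have : (scale j)%:Z * D.+1 <= x j.
  by apply: H; move: yj; rewrite /N; nia.
have := scale_gt0 j; nia.
Qed.

(** Around a point of a member [W] of the [j]-th family, [low_side j] does not
change: a cell that contains such a point meets no other member, as members are
farther apart than the size of the cell. *)
Lemma low_side_cell j W x y : (j < d)%N -> Fam j W -> W x ->
  box (scale j) y x -> low_side j y = `[< reaches_low j W >].
Proof.
move=> jd FW Wx bx; apply/asbool_equiv_eq; split=> [|lW]; last first.
  by right; exists W; split=> //; exists x.
move=> [yj|[W' [FW' lW' [x' Wx' bx']]]].
  by exists x => //; have [_] := bx j 0 jd; rewrite mulr0; apply; lia.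
suff -> : W = W' by [].
by apply: (Fam_disjoint jd FW FW' Wx Wx') => i id; apply: box_close bx bx'.
Qed.

Let z := chain d low_side.

(** The [i]-th wall avoids the [i]-th family by [low_side_cell], and cutting
further only passes to faces. *)
Lemma chain_uncovered j i y W x : (j <= d)%N -> (i < j)%N -> z j y != 0 ->
  Fam i W -> box (scale i) y x -> ~ W x.
Proof.
elim: j y => // j IH y jd; rewrite ltnS leq_eqVlt => /predU1P[->|ij] nz FW bx.
  move=> Wx; move/eqP: nz; apply.
  apply: (@chain_eq0_const _ _ _ _ `[< reaches_low j W >]).
  by move=> y' yy' _; apply: low_side_cell FW Wx (box_coface yy' bx).
have [y' yy' nz'] := chain_coface nz.
exact: IH (ltnW jd) ij nz' FW (box_coface yy' bx).
Qed.

(** The first [n] chains are sums of whole faces of the coarse grid.  If the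
even coordinate [y i] were not on the grid, the only cofaces of [y] in the
previous chain would be its two neighbours in direction [i]; these have the same
coarse cell, so [low_side j] does not distinguish them. *)
Lemma chain_coarse j y i : (j <= n)%N -> z j y != 0 -> (i < d)%N ->
  evenz (y i) -> ((m%:Z *+ 2) %| y i)%Z.
Proof.
elim: j y i => [|j IH] y i jn.
  move=> nz id yi; exfalso; move: nz; rewrite /z /=.
  by case: forallP => [/(_ (Ordinal id))/=|]; rewrite ?yi ?eqxx.
move=> nz id yi; apply: contra_neqT nz => ndvd.
have sE : scale j = m by rewrite /scale jn.
apply: (@chain_eq0_const _ _ _ _ (low_side j (upd y i (y i + 1)))).
move=> y' [l [ld yl] y'E] nz.
have [li|li] := eqVneq l i; last first.
  have y'i : y' i = y i by case: y'E => ->; rewrite upd_other// eq_sym.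
  by have := IH _ _ (ltnW jn) nz id; rewrite y'i (negPf ndvd) => /(_ yi).
rewrite {}li in y'E; case: y'E => -> //.
rewrite /low_side sE; apply/asbool_equiv_eq; split.
  case=> [yj|[W [FW lW [x Wx bx]]]]; [left|right].
    move: yj; have [->|ji] := eqVneq j i; last by rewrite !upd_other.
    rewrite !upd_same; have : y i != 0 by apply: contraNneq ndvd => ->.
    by move: yi; rewrite /evenz; lia.
  by exists W; split=> //; exists x => //; apply/(box_flip _ yi ndvd).
case=> [yj|[W [FW lW [x Wx bx]]]]; [left|right].
  move: yj; have [->|ji] := eqVneq j i; last by rewrite !upd_other.
  rewrite !upd_same; lia.
by exists W; split=> //; exists x => //; apply/(box_flip _ yi ndvd).
Qed.

Lemma chain_skeleton j y : (n <= j)%N -> z j y != 0 ->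
  (#|[pred i : 'I_d | ~~ ((m%:Z *+ 2) %| y i)%Z]| <= d - n)%N.
Proof.
move=> /subnK <-; elim: (j - n)%N y => [|{}j IH] y.
  rewrite add0n => nz; rewrite -(chain_even_card nz).
  rewrite -[X in (_ <= X - _)%N]card_ord -(cardC [pred i : 'I_d | evenz (y i)]).
  rewrite addKn; apply: subset_leq_card.
  apply/fintype.subsetP => i; rewrite !inE.
  by apply: contra => /(chain_coarse (leqnn n) nz (ltn_ord i)).
rewrite addSn => /chain_coface[y' yy' /IH]; apply: leq_trans.
apply: subset_leq_card; apply/fintype.subsetP => i; rewrite !inE; apply: contra.
have := coface_coord i yy'; case=> [->//|[yi y'i]].
have : (2 %| m%:Z *+ 2)%Z by lia.
by move=> /dvdz_trans h /h; move: yi; rewrite /evenz; lia.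
Qed.

(** Lebesgue covering property of the skeleton of dimension [d - n] of the grid
of mesh [m]: it is not covered by [d] families of bounded sets of which [n] are
separated at scale [m] and the others at scale 1. *)
Lemma skeleton_not_covered :
  (forall x, (#|[pred i : 'I_d | ~~ (m%:Z %| x i)%Z]| <= d - n)%N ->
    exists j W, [/\ (j < d)%N, Fam j W & W x]) -> False.
Proof.
move=> cover; have := chain_odd low_side_neg low_side_big (leqnn d).
move=> z1; have /boxsum_neq0[y [ev od nz]] :
    boxsum N (rev (iota 0 d)) (z d) (fun=> -1) != 0 by rewrite /z z1.
(* All coordinates of [y] are even: it is a vertex, left over by all cuts. *)
pose x i := (y i %/ 2)%Z.
have xy i : (i < d)%N -> y i = x i *+ 2.
  move=> id; have : evenz (y i) by apply: ev; rewrite mem_rev mem_iota.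
  by rewrite /x /evenz; lia.
have [|j [W [jd FW Wx]]] := cover x.
  apply: leq_trans (chain_skeleton n_le_d nz); apply: subset_leq_card.
  apply/fintype.subsetP => i; rewrite !inE xy//; apply: contra.
  by rewrite -[x i *+ 2]mulr_natr -[m%:Z *+ 2]mulr_natr dvdz_mul2r.
apply: (chain_uncovered (leqnn d) jd nz FW _ Wx) => i q id.
by rewrite xy//; split; lia.
Qed.
End LatticeCover.

(** * Metric preliminaries *)

Section Families.
Context {R : realType} {X : metricType R}.
Implicit Types (U V : set X) (F : set (set X)).

Lemma set_dist_lt_mdist (r : R) U V (x y : X) :
  (r%:E < set_dist U V)%E -> U x -> V y -> r < mdist x y.
Proof.
move=> rUV Ux Vy; rewrite -lte_fin; apply: lt_le_trans rUV _.
by apply: ereal_inf_lbound; exists x => //; exists y.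
Qed.

Lemma lt_set_dist (r h : R) U V : r < h ->
  (forall x y, U x -> V y -> h <= mdist x y) -> (r%:E < set_dist U V)%E.
Proof.
move=> rh hUV; apply: (@lt_le_trans _ _ h%:E); first by rewrite lte_fin.
by apply: le_ereal_inf_tmp => _ [x Ux [y Vy <-]]; rewrite lee_fin hUV.
Qed.

Lemma uniformly_bounded_mdist F : uniformly_bounded F ->
  exists D : nat, forall U x y, F U -> U x -> U y -> mdist x y <= D%:R.
Proof.
rewrite /uniformly_bounded; set S := ereal_sup _ => Slt.
exists (Num.bound (fine S)) => U x y FU Ux Uy.
have xyS : ((mdist x y)%:E <= S)%E.
  apply: (@le_trans _ _ (diam U)); last by apply: ereal_sup_ubound; exists U.
  by apply: ereal_sup_ubound; exists x => //; exists y.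
have Sfin : S \is a fin_num.
  by rewrite fin_numE -ltey Slt andbT -ltNye (lt_le_trans _ xyS)// ltNyr.
have xyf : mdist x y <= fine S by rewrite -lee_fin fineK.
apply: le_trans (xyf) _; apply: ltW.
by apply: archi_boundP; apply: le_trans xyf; apply: mdist_ge0.
Qed.

Lemma mdist_uniformly_bounded (D : R) F :
  (forall U x y, F U -> U x -> U y -> mdist x y <= D) -> uniformly_bounded F.
Proof.
move=> FD; apply: (@le_lt_trans _ _ D%:E); last exact: ltry.
apply: ge_ereal_sup => _ [U FU <-]; apply: ge_ereal_sup => _ [x Ux [y Uy <-]].
by rewrite lee_fin (FD U).
Qed.
End Families.

Section Space.
Context {R : realType}.

Lemma mdist_coord (x y : finsupp_seq R) j : `|x j - y j| <= mdist x y.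
Proof.
have [jS|] := boolP (j \in (finsupp x `|` finsupp y)%fset).
  exact: (le_bigmax_seq 0 j xpredT (fun i => `|x i - y i|)).
rewrite in_fsetU negb_or => /andP[jx jy].
by rewrite !fsfun_dflt// subrr normr0 mdist_ge0.
Qed.

Lemma mdist_le_coord (x y : finsupp_seq R) (e : R) :
  0 <= e -> (forall j, `|x j - y j| <= e) -> mdist x y <= e.
Proof. by move=> e0 H; apply: bigmax_le. Qed.

Context (k : nat).
Implicit Types p q : X_omega R k.

Lemma mdist_X_omega p q :
  mdist p q = mdist (val p).2 (val q).2 + (as_gap (val p).1 (val q).1)%:R.
Proof. by []. Qed.

Lemma as_gapxx l : as_gap l l = 0%N.
Proof. by rewrite /as_gap minnn maxnn big_geq. Qed.

End Space.

(** * The lower bound *)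

Section LowerBound.
Context {R : realType} (k : nat).

Definition lattice_point (d : nat) (x : nat -> int) : finsupp_seq R :=
  [fsfun i in seq_fset tt (iota 0 d) => (x i)%:~R].

Lemma lattice_pointE d x i :
  lattice_point d x i = if (i < d)%N then (x i)%:~R else 0.
Proof. by rewrite fsfunE seq_fsetE mem_iota. Qed.

Lemma lattice_point_in d (x : nat -> int) :
  (#|[pred i : 'I_d | ~~ ((2 ^ d)%N%:Z %| x i)%Z]| <= k)%N ->
  X_omega_piece R k d (lattice_point d x).
Proof.
move=> xk; split=> [j dj|]; first by rewrite lattice_pointE ltnNge dj.
apply: leq_trans xk; apply: subset_leq_card; apply/fintype.subsetP => i.
rewrite !inE; apply: contra => /dvdzP[q xq]; apply/mem_set; exists q => //.
by rewrite lattice_pointE ltn_ord xq intrM mulrC -natrX.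
Qed.

(** The scale of the family attached to direction [j]: the [n] first ones exceed
the mesh [2 ^ (n + k)] and differ from the others, which are [1, ..., k]. *)
Definition colour (n j : nat) : nat :=
  if (j < n)%N then (2 ^ (n + k) + k.+1 + j)%N else (j - n).+1.

Lemma trasdim_family_colours n : (0 < k + n)%N ->
  trasdim_family (X_omega R k)
    (seq_fset tt [seq colour n j | j <- iota 0 n] `|`
     seq_fset tt (iota 1 k))%fset.
Proof.
move=> kn0; set d := (n + k)%N; set sg := (_ `|` _)%fset.
have mem_sg i : i \in sg = [exists j : 'I_d, i == colour n j].
  rewrite in_fsetU !seq_fsetE mem_iota.
  apply/orP/existsP => [[/mapP[j]|ik]|[j /eqP->]].
  - rewrite mem_iota add0n => jn ->.
    by exists (Ordinal (ltn_addr k jn)).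
  - have dj : (n + i.-1 < d)%N by rewrite /d; lia.
    by exists (Ordinal dj); rewrite /colour /= ltnNge leq_addr /=; lia.
  - have [jn|nj] := ltnP j n; [left|right].
      by apply/mapP; exists (j : nat) => //; rewrite mem_iota.
    have : (j < n + k)%N := ltn_ord j.
    by rewrite /colour ifN -?leqNgt//; lia.
split.
  split.
    have d0 : (0 < d)%N by rewrite /d addnC.
    apply/fset0Pn; exists (colour n (Ordinal d0)).
    by rewrite mem_sg; apply/existsP; exists (Ordinal d0).
  rewrite mem_sg; apply/existsP => -[j].
  by rewrite /colour; case: ifP => _; lia.
move=> [F [Fbd Fdisj Fcov]].
have sgP j : (j < d)%N -> colour n j \in sg.
  by move=> jd; rewrite mem_sg; apply/existsP; exists (Ordinal jd).
have [D FD] : exists D : nat, forall j U x y, (j < d)%N -> F (colour n j) U ->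
    U x -> U y -> mdist x y <= D%:R.
  have /choice[D FD] j : exists D : nat, forall U x y, (j < d)%N ->
      F (colour n j) U -> U x -> U y -> mdist x y <= D%:R.
    have [jd|_] := ltnP j d; last by exists 0%N.
    have [D DP] := uniformly_bounded_mdist (Fbd _ (sgP _ jd)).
    by exists D => U x y _; apply: DP.
  exists (\max_(j < d) D j) => j U x y jd FU Ux Uy.
  apply: le_trans (FD _ _ _ _ jd FU Ux Uy) _; rewrite ler_nat.
  exact: (leq_bigmax (Ordinal jd)).
pose Fam j : set (set (nat -> int)) :=
  [set [set x | exists2 p : X_omega R k, U p & val p = (d, lattice_point d x)] |
    U in F (colour n j)].
have mdE (p q : X_omega R k) x y : val p = (d, lattice_point d x) ->
    val q = (d, lattice_point d y) ->
    mdist p q = mdist (lattice_point d x) (lattice_point d y).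
  by move=> px qy; rewrite mdist_X_omega px qy as_gapxx addr0.
apply: (@skeleton_not_covered d (2 ^ d) n Fam D).
- by rewrite expn_gt0.
- exact: leq_addr.
- move=> j _ _ x y jd [U FU <-] [V FV <-] [p Up px] [q Vq qy] xy.
  have [->//|/eqP UV] := eqVneq U V; exfalso.
  have := set_dist_lt_mdist (Fdisj _ (sgP _ jd) _ _ FU FV UV) Up Vq.
  apply/negP; rewrite -leNgt (mdE _ _ _ _ px qy).
  apply: (@le_trans _ _ (scale (2 ^ d) n j)%:R); last first.
    rewrite ler_nat /scale /colour; case: ifP => _ //.
    by rewrite -addnA leq_addr.
  apply: mdist_le_coord => // i; rewrite !lattice_pointE.
  case: ltnP => [id|_]; last by rewrite subrr normr0.
  by rewrite -intrB -intr_norm -[_%:R]/(_%:Z%:~R) ler_int xy.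
- move=> j _ x y jd [U FU <-] [p Up px] [q Uq qy].
  have := FD _ _ _ _ jd FU Up Uq; rewrite (mdE _ _ _ _ px qy) => pD.
  have := le_trans (mdist_coord _ _ j) pD.
  rewrite !lattice_pointE jd => /(le_trans (ler_norm _)).
  by rewrite -intrB -[D%:R]/(D%:Z%:~R) ler_int.
move=> x; rewrite addKn => xk.
have px : as_union_points (X_omega_piece R k) (d, lattice_point d x).
  by split; [rewrite /d /= addnC|exact: lattice_point_in].
pose p : X_omega R k := SigSub (mem_set px).
have : setT p by [].
rewrite -Fcov => -[i /= isg [U FU Up]]; move: isg; rewrite mem_sg.
case/existsP=> j /eqP iE; rewrite iE in FU.
exists (j : nat), [set x | exists2 p, U p & val p = (d, lattice_point d x)].
by split; [exact: ltn_ord|exists U|exists p].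
Qed.

Theorem trasdim_X_omega_ge (b : ord) : (0 < k)%N ->
  Ord_le (trasdim_family (X_omega R k)) b -> ~ olt b (omega_plus k).
Proof.
move=> k0; apply: (@Ord_ge_omega_plus k _ (seq_fset tt (iota 1 k))).
- by rewrite seq_fsetE mem_iota.
- by rewrite size_seq_fset undup_id ?iota_uniq// size_iota.
move=> n; exists (seq_fset tt [seq colour n.+1 j | j <- iota 0 n.+1]).
split; last by apply: trasdim_family_colours; rewrite addnS.
- split.
    apply/fset0Pn; exists (colour n.+1 0); rewrite seq_fsetE.
    by apply/mapP; exists 0%N => //; rewrite mem_iota.
  rewrite seq_fsetE; apply/mapP => -[j _].
  by rewrite /colour; case: ifP => _; lia.
- rewrite size_seq_fset undup_id ?size_map ?size_iota//.
  rewrite map_inj_in_uniq ?iota_uniq// => i j.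
  by rewrite !mem_iota /colour => /andP[_ ->] /andP[_ ->]; lia.
- apply/fsetP => i; rewrite in_fsetI !seq_fsetE mem_iota inE.
  by apply/andP => -[/mapP[j]]; rewrite mem_iota /colour => /andP[_ ->]; lia.
Qed.
End LowerBound.

(** * The upper bound *)

Section Grid.
Context {R : realType} (L h : R).
Hypothesis L_gt0 : 0 < L.
Hypothesis h_ge0 : 0 <= h.
Implicit Types (t u : R) (c : nat).

(** The [c]-th cell of [t] records the grid points of mesh [L] within distance
[c * h]: if there is one, both components are its index, otherwise they are the
indices, in decreasing order, of the two neighbours of [t] (for [c * h] less
than half the mesh). *)
Definition lower c t : int := Num.ceil ((t - c%:R * h) / L).
Definition upper c t : int := Num.floor ((t + c%:R * h) / L).
Definition cell c t : int * int := (lower c t, upper c t).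

Lemma lower_le c t c' t' : t - c%:R * h <= t' - c'%:R * h ->
  lower c t <= lower c' t'.
Proof. by move=> tt'; apply: le_ceil; rewrite ler_pM2r ?invr_gt0. Qed.

Lemma upper_le c t c' t' : t + c%:R * h <= t' + c'%:R * h ->
  upper c t <= upper c' t'.
Proof. by move=> tt'; apply: le_floor; rewrite ler_pM2r ?invr_gt0. Qed.

(** If a point keeps its cell when the tolerance grows by [h], no point at
distance at most [h] can have another cell, unless its own cell changes. *)
Lemma cell_near c t u : cell c t = cell c.+1 t -> cell c u = cell c.+1 u ->
  `|t - u| <= h -> cell c t = cell c u.
Proof.
wlog tu : t u / t <= u.
  move=> H; have [/H//|/ltW/H {}H gt gu tu] := leP t u.
  by rewrite (H gu gt)// distrC.
move=> [lt ut] [lu uu]; rewrite distrC ger0_norm ?subr_ge0// => ut_h.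
congr (_, _); apply: le_anti; apply/andP; split.
- by apply: lower_le; rewrite lerD2r.
- by rewrite lu; apply: lower_le; rewrite -natr1; lra.
- by apply: upper_le; rewrite lerD2r.
- by rewrite ut; apply: upper_le; rewrite -natr1; lra.
Qed.

Lemma cell_width c t u : lower c t = lower c u -> `|t - u| <= L.
Proof.
wlog tu : t u / t <= u.
  by move=> H; have [/H//|/ltW/H {}H e] := leP t u; rewrite distrC H.
move=> e; rewrite distrC ger0_norm ?subr_ge0//.
have /andP[lt _] := ceil_itv ((t - c%:R * h) / L).
have /andP[_ ul] := ceil_itv ((u - c%:R * h) / L).
rewrite -/(lower c t) e intrD in lt; rewrite -/(lower c u) in ul.
have : (u - c%:R * h) / L < (t - c%:R * h) / L + 1 by lra.
rewrite -[X in _ < _ + X](divff (lt0r_neq0 L_gt0)) -mulrDl ltr_pM2r ?invr_gt0//.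
lra.
Qed.

Definition on_grid t : bool := `[< exists q : int, t = L * q%:~R >].

(** The difference of the two components never decreases in [c], starts at [-1]
(at [0] on the grid), and remains nonpositive: it increases at most once. *)
Lemma cell_changes (N : nat) t : (N%:R * h) *+ 2 < L ->
  (\sum_(c < N) (cell c t != cell c.+1 t) <= ~~ on_grid t)%N.
Proof.
move=> hN; pose w c : int := upper c t - lower c t.
have step c : (cell c t != cell c.+1 t)%:Z <= w c.+1 - w c.
  have l : lower c.+1 t <= lower c t.
    by apply: lower_le; rewrite lerB ?ler_wpM2r ?ler_nat.
  have u : upper c t <= upper c.+1 t.
    by apply: upper_le; rewrite lerD2l ler_wpM2r ?ler_nat.
  rewrite xpair_eqE; move: l u; rewrite /w; lia.
have total M : (\sum_(c < M) (cell c t != cell c.+1 t))%N%:Z <= w M - w 0%N.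
  elim: M => [|M IH]; first by rewrite big_ord0 subrr.
  rewrite big_ord_recr PoszD; apply: le_trans (lerD IH (step M)) _.
  by rewrite addrC subrKA.
have wN : w N <= 0.
  rewrite subr_le0 -ltzD1 -(ltr_int R).
  apply: le_lt_trans (floor_le _) _.
  rewrite intrD; apply: lt_le_trans (_ : _ < (t - N%:R * h) / L + 1) _.
    rewrite -[X in _ < _ + X](divff (lt0r_neq0 L_gt0)) -mulrDl.
    by rewrite ltr_pM2r ?invr_gt0//; lra.
  by rewrite lerD2r ceil_ge.
have w0 : - (~~ on_grid t)%:Z <= w 0%N.
  rewrite /w /upper /lower !mul0r addr0 subr0 ceil_floor.
  case tL : (on_grid t); last first.
    by rewrite opprD addNKr lerN2 lez_nat leq_b1.
  have /asboolP[q ->] := tL; rewrite mulrAC divff ?lt0r_neq0// mul1r.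
  by rewrite intr_int addr0 subrr.
by move: (total N) wN w0; lia.
Qed.

(** Pigeonhole: each of the at most [k] coordinates off the grid spoils at most
one of the [k.+1] values of [c]. *)
Lemma stable_cell_exists (k d : nat) (x : nat -> R) : (k.+1%:R * h) *+ 2 < L ->
  (forall j, (d <= j)%N -> x j = 0) ->
  (#|[pred j : 'I_d | ~~ on_grid (x j)]| <= k)%N ->
  exists2 c, (c <= k)%N & forall j, cell c (x j) = cell c.+1 (x j).
Proof.
move=> hL x0 xk; pose bad (c j : nat) := cell c (x j) != cell c.+1 (x j).
apply: contrapT => nc.
have badE (c : 'I_k.+1) : (1 <= \sum_(j < d) bad c j)%N.
  rewrite lt0n; apply: contra_notN nc; rewrite sum_nat_eq0 => /forallP bad0.
  exists c; first by rewrite -ltnS.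
  move=> j; apply/eqP; have [jd|dj] := ltnP j d.
    by have := bad0 (Ordinal jd); rewrite eqb0 negbK.
  rewrite (x0 j dj); have := cell_changes 0 hL.
  have -> : on_grid 0 by apply/asboolP; exists 0; rewrite mulr0.
  by rewrite leqn0 sum_nat_eq0 => /forallP/(_ c); rewrite eqb0 negbK.
suff : (k.+1 <= k)%N by rewrite ltnn.
apply: leq_trans xk.
have : (\sum_(c < k.+1) 1 <= \sum_(c < k.+1) \sum_(j < d) bad c j)%N.
  by apply: leq_sum => c _; exact: badE.
rewrite sum1_card card_ord => /leq_trans; apply.
rewrite exchange_big /= -sum1_card [X in (_ <= X)%N]big_mkcond /=.
apply: leq_sum => j _; apply: leq_trans (cell_changes (x j) hL) _.
by rewrite inE; case: on_grid.
Qed.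

(* The construction is applied to the union of the pieces with index in [I];
   pieces with the same label [lab] may share members of the families. *)
Context (k : nat) (I : pred nat) (lab : nat -> nat).
Implicit Types p : X_omega R k.

Definition cell_class c p : set (X_omega R k) :=
  [set q : X_omega R k | [/\ I (val q).1,
    forall j, cell c ((val q).2 j) = cell c.+1 ((val q).2 j),
    lab (val q).1 = lab (val p).1 &
    forall j, cell c ((val q).2 j) = cell c ((val p).2 j)]].

Definition cell_family c : set (set (X_omega R k)) := range (cell_class c).

Lemma cell_family_bounded c (G : nat) :
  (forall l l', I l -> I l' -> lab l = lab l' -> (as_gap l l' <= G)%N) ->
  uniformly_bounded (cell_family c).
Proof.
move=> gapG; apply: (@mdist_uniformly_bounded _ _ (L + G%:R)).
move=> _ q r [p _ <-] [Iq _ lq cq] [Ir _ lr cr].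
rewrite mdist_X_omega lerD ?ler_nat ?gapG ?lq ?lr//.
apply: mdist_le_coord => [|j]; first exact: ltW.
by apply: (@cell_width c); have [] := etrans (cq j) (esym (cr j)).
Qed.

Lemma cell_family_disjoint c (r : R) : r < h ->
  (forall l l', I l -> I l' -> lab l != lab l' -> h <= (as_gap l l')%:R) ->
  disjoint_family r (cell_family c).
Proof.
move=> rh gaph _ _ [p _ <-] [p' _ <-] pp'; apply: (lt_set_dist rh).
move=> q q' [Iq gq lq cq] [Iq' gq' lq' cq']; rewrite mdist_X_omega.
have [ll|ll] := eqVneq (lab (val q).1) (lab (val q').1); last first.
  by apply: le_trans (gaph _ _ Iq Iq' ll) _; rewrite lerDr mdist_ge0.
rewrite leNgt; apply/negP => qq'; apply: pp'.
have cqq' j : cell c ((val q).2 j) = cell c ((val q').2 j).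
  apply: cell_near => //; apply: le_trans (mdist_coord _ _ j) _.
  by apply: ltW; apply: le_lt_trans qq'; rewrite lerDl ler0n.
apply/seteqP; split=> u [Iu gu lu cu]; split=> // [|j].
- by rewrite lu -lq ll lq'.
- by rewrite cu -cq cqq' cq'.
- by rewrite lu -lq' -ll lq.
- by rewrite cu -cq' -cqq' cq.
Qed.

Lemma cell_family_cover n p : (n.+1%:R * h) *+ 2 < L -> I (val p).1 ->
  (#|[pred j : 'I_(val p).1 | ~~ on_grid ((val p).2 j)]| <= n)%N ->
  exists c U, [/\ (c <= n)%N, cell_family c U & U p].
Proof.
move=> hL Ip pn; have [_ [p0 _]] := set_mem (valP p).
have [c cn gc] := stable_cell_exists hL p0 pn.
by exists c, (cell_class c p); split=> //; exists p.
Qed.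

End Grid.

Section UpperBound.
Context {R : realType} (k : nat).

Lemma leq_as_gap a b n : (n <= a)%N -> (n <= b)%N -> a != b ->
  (n <= as_gap a b)%N.
Proof.
move=> na nb ab; rewrite /as_gap big_ltn; last first.
  by rewrite gtn_min !leq_max !ltnn orbF -neq_ltn.
by apply: leq_trans (leq_addr _ _); rewrite leq_min na.
Qed.

Lemma as_gap_leq a b n : (a < n)%N -> (b < n)%N -> (as_gap a b <= n * n)%N.
Proof.
move=> an bn; rewrite /as_gap big_nat_cond.
apply: (@leq_trans (\sum_(minn a b <= i < maxn a b) n)%N).
  rewrite [X in (_ <= X)%N]big_nat_cond.
  apply: leq_sum => i /andP[/andP[_ ib] _].
  by apply: ltnW; apply: leq_trans ib _; rewrite geq_max (ltnW an) (ltnW bn).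
by rewrite sum_nat_const_nat leq_mul2r; lia.
Qed.

Lemma two_pow_Z_le (q l : nat) (t : R) : (q <= l)%N ->
  two_pow_Z R l t -> on_grid (2 ^+ q) t.
Proof.
move=> ql [a _ <-]; apply/asboolP; exists (2 ^+ (l - q) * a).
by rewrite rmorphM rmorphXn /= mulrA -exprD subnKC.
Qed.

Theorem trasdim_X_omega_le :
  Ord_le (trasdim_family (X_omega R k)) (omega_plus k).
Proof.
apply: Ord_le_omega_plus => s [s0 sn0] sk.
pose bound (u : {fset nat}) := (\max_(i <- enum_fset u) i).+1.
have boundP u i : i \in u -> i%:R < (bound u)%:R :> R.
  by move=> iu; rewrite ltr_nat ltnS; apply: leq_bigmax_seq.
(* Large enough for [2 ^ q] to be a suitable mesh at the scales in [s], and for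
   pieces of index at least [q] to be farther apart than these scales. *)
pose q := (k.+1 * bound s * 2)%N.
exists q => t [_ [_ ncov] ts]; rewrite leqNgt; apply/negP => qt; apply: ncov.
pose L := 2 ^+ q : R; pose h := (bound s)%:R : R.
have L0 : 0 < L by rewrite exprn_gt0.
have hL : (k.+1%:R * h) *+ 2 < L.
  by rewrite /h /L -natrM -mulrnA -natrX ltr_nat ltn_expl.
(* The scales in [t] are unrelated to [q], so they get a mesh of their own. *)
pose h' := (bound t)%:R : R; pose L' := (q.+1%:R * h') *+ 2 + 1.
have h'0 : 0 <= h' by exact: ler0n.
have L'0 : 0 < L' by rewrite ltr_wpDl// mulrn_wge0// mulr_ge0.
pose tail l := (q <= l)%N; pose head l := (l < q)%N.
pose far c := @cell_family R L h k tail id c.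
pose near c := @cell_family R L' h' k head (fun=> 0%N) c.
pose F i := if i \in s then far (index i s) else near (index i t).
exists F; split=> [i|i|].
- rewrite inE /F; case: ifP => [_ _|_ _].
    apply: (@cell_family_bounded _ _ _ L0 _ _ _ _ 0) => l l' _ _ ->.
    by rewrite as_gapxx.
  apply: (@cell_family_bounded _ _ _ L'0 _ _ _ _ (q * q)) => l l' lq lq' _.
  exact: as_gap_leq.
- rewrite inE /F; case: ifP => [is_ _|_]; last rewrite orbF => it.
    apply: (cell_family_disjoint L0); first exact: boundP.
    move=> l l' ql ql' ll'; rewrite ler_nat.
    apply: leq_trans (leq_as_gap ql ql' ll').
    by rewrite /q; nia.
  apply: (cell_family_disjoint L'0); first exact: boundP.
  by move=> l l' _ _; rewrite eqxx.
apply/seteqP; split=> // p _; have [_ [p0 pk]] := set_mem (valP p).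
have [qp|pq] := leqP q (val p).1.
  have [|c [U [ck FU Up]]] :=
      @cell_family_cover R L h L0 (ler0n _ _) k tail id k p hL qp.
    apply: leq_trans pk; apply: subset_leq_card; apply/fintype.subsetP => j.
    rewrite !inE; apply: contra => /set_mem; exact: two_pow_Z_le.
  have cs : (c < size s)%N by rewrite sk ltnS.
  exists (nth 0%N s c) => /=; first by rewrite inE mem_nth ?orbT.
  by exists U => //; rewrite /F mem_nth// index_uniq// fset_uniq.
have L'h' : (q.+1%:R * h') *+ 2 < L' by rewrite ltrDl.
have [|c [U [cq FU Up]]] :=
    @cell_family_cover R L' h' L'0 h'0 k head (fun=> 0%N) q p L'h' pq.
  by apply: leq_trans (max_card _) _; rewrite card_ord ltnW.
have ct : (c < size t)%N by apply: leq_ltn_trans cq qt.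
exists (nth 0%N t c) => /=; first by rewrite inE mem_nth.
exists U => //; rewrite /F index_uniq ?fset_uniq//.
case: ifP => // nts; move/fsetP: ts => /(_ (nth 0%N t c)).
by rewrite !inE mem_nth// nts.
Qed.
End UpperBound.

Theorem theorem3p1 (R : realType) (k : nat) (k_gt0 : (0 < k)%N) :
  trasdim_eq (X_omega R k) (omega_plus k).
Proof.
split; first exact: trasdim_X_omega_le.
by case=> b bk Mb; apply: trasdim_X_omega_ge Mb bk.
Qed.
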